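(* There exists a graph whose circle packings cannot be constructed by a quadratic computation tree; that is, no circle packing representing this graph can be constructed by a quadratic computation tree.
   Context: A circle packing representing a planar graph $G$ is a collection of circles in the plane with pairwise disjoint interiors, one for each vertex, such that the circles of two adjacent vertices are tangent. Points of the plane are identified with complex numbers; constructing a packing means computing the centers and radii of all its circles. An algebraic computation tree is a rooted tree whose computation nodes compute a value as the sum, difference, product or quotient of integer constants and values computed at ancestor nodes, and whose decision nodes test whether a computed value is greater than zero and branch. A quadratic computation tree additionally allows square roots and complex conjugation of previously computed values. *)

(* Defs.v *)
From HB Require Import structures.
From mathcomp Require Import all_boot all_order all_algebra.
From mathcomp Require Import complex.
From mathcomp Require Import reals.
Set Implicit Arguments. Unset Strict Implicit. Unset Printing Implicit Defensive.
Import Order.TTheory GRing.Theory Num.Theory.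
Local Open Scope ring_scope.

Definition simple_graph (n : nat) (adj : rel 'I_n) : Prop :=
  (forall u v, adj u v = adj v u) /\ (forall u, ~~ adj u u).

(* Circle of vertex v: centre cen v, radius rad v (a positive real,   *)
(* i.e. 0 < rad v in the order of R[i], which forces Im = 0).          *)
Section Packing.
Variable R : rcfType.

Definition in_interior (c r z : R[i]) : Prop := `|z - c| < r.
Definition on_circle (c r z : R[i]) : Prop := `|z - c| = r.

Definition tangent (c1 r1 c2 r2 : R[i]) : Prop :=
  exists z, (on_circle c1 r1 z /\ on_circle c2 r2 z) /\
    forall w, on_circle c1 r1 w -> on_circle c2 r2 w -> w = z.

Definition circle_packing (n : nat) (adj : rel 'I_n)
    (cen rad : 'I_n -> R[i]) : Prop :=
  [/\ forall v, 0 < rad v,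
      forall u v, u != v ->
        ~ (exists z, in_interior (cen u) (rad u) z /\ in_interior (cen v) (rad v) z)
    & forall u v, adj u v -> tangent (cen u) (rad u) (cen v) (rad v)].
End Packing.

(* Quadratic computation trees (with no input: the graph is fixed).    *)
(* Values computed at the ancestors of a node are stored in a list,    *)
(* in order of computation; a node refers to them by their position.   *)
(* A leaf outputs, for each vertex v, the position of the value giving *)
(* the centre of the circle of v and that giving its radius.           *)
Inductive qtree (n : nat) : Type :=
| QLeaf   of ('I_n -> nat) & ('I_n -> nat)
| QConst  of int & qtree n
| QAdd    of nat & nat & qtree n
| QSub    of nat & nat & qtree n
| QMul    of nat & nat & qtree n
| QDiv    of nat & nat & qtree n
| QSqrt   of nat & qtree n
| QConj   of nat & qtree n
| QBranch of nat & qtree n & qtree n.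

Section Run.
Variable R : rcfType.

(* qrun s t cen rad : executing t, with already computed values s,
   may end at a leaf producing centres cen and radii rad.
   Square roots are nondeterministic: any w with w * w = x may be taken.
   Decision nodes test 0 < x (for x in R[i]: x is a positive real). *)
Inductive qrun (n : nat) :
    seq R[i] -> qtree n -> ('I_n -> R[i]) -> ('I_n -> R[i]) -> Prop :=
| run_leaf s fc fr :
    (forall v, fc v < size s)%N -> (forall v, fr v < size s)%N ->
    qrun s (QLeaf fc fr) (fun v => nth 0 s (fc v)) (fun v => nth 0 s (fr v))
| run_const s k t cen rad :
    qrun (rcons s (k%:~R)) t cen rad -> qrun s (QConst k t) cen rad
| run_add s i j t cen rad :
    (i < size s)%N -> (j < size s)%N ->
    qrun (rcons s (nth 0 s i + nth 0 s j)) t cen rad -> qrun s (QAdd i j t) cen rad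
| run_sub s i j t cen rad :
    (i < size s)%N -> (j < size s)%N ->
    qrun (rcons s (nth 0 s i - nth 0 s j)) t cen rad -> qrun s (QSub i j t) cen rad
| run_mul s i j t cen rad :
    (i < size s)%N -> (j < size s)%N ->
    qrun (rcons s (nth 0 s i * nth 0 s j)) t cen rad -> qrun s (QMul i j t) cen rad
| run_div s i j t cen rad :
    (i < size s)%N -> (j < size s)%N -> nth 0 s j != 0 ->
    qrun (rcons s (nth 0 s i / nth 0 s j)) t cen rad -> qrun s (QDiv i j t) cen rad
| run_sqrt s i w t cen rad :
    (i < size s)%N -> w * w = nth 0 s i ->
    qrun (rcons s w) t cen rad -> qrun s (QSqrt i t) cen rad
| run_conj s i t cen rad :
    (i < size s)%N ->
    qrun (rcons s (conjc (nth 0 s i))) t cen rad -> qrun s (QConj i t) cen rad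
| run_branch_pos s i t1 t2 cen rad :
    (i < size s)%N -> 0 < nth 0 s i ->
    qrun s t1 cen rad -> qrun s (QBranch i t1 t2) cen rad
| run_branch_npos s i t1 t2 cen rad :
    (i < size s)%N -> ~~ (0 < nth 0 s i) ->
    qrun s t2 cen rad -> qrun s (QBranch i t1 t2) cen rad.
End Run.

Definition qtree_constructs_packing (R : rcfType) (n : nat) (adj : rel 'I_n)
    (t : qtree n) : Prop :=
  exists cen rad, qrun (R := R) [::] t cen rad /\ circle_packing adj cen rad.

(* Main.v *)
(* The graph is the bipyramid over a heptagon: a packing of it is a closed
   Steiner chain of seven circles around two circles [a] and [b].  Represent a
   circle of centre [z] and radius [r] by the vector
   (1, z, conj z, z conj z - r^2) / r and use the Lorentzian product, for which
   circles are tangent when their product is -1.  If -D is the product of [a]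
   and [b], linear algebra in dimension four shows that the chain satisfies
     c_(i+2) + c_i = lam c_(i+1) + mu (a + b),   lam = (6 - 2 D) / (1 + D),
   and seven-periodicity forces lam^3 + lam^2 - 2 lam - 1 = 0, that is
   lam = 2 cos (2 pi j / 7).  A cubic over Q without rational roots acquires
   no root in a tower of quadratic extensions, so [lam], which is rational in
   the centres and radii, cannot be computed.
   For existence, the symmetric packing of the sphere is projected
   stereographically from the point (-12/13, 0, 5/13), which lies in a gap
   between its discs. *)

Require Import Defs.
From HB Require Import structures.
From mathcomp Require Import all_boot all_order all_algebra.
From mathcomp Require Import complex.
From mathcomp Require Import reals.
From mathcomp Require Import ring lra zify.

Set Implicit Arguments. Unset Strict Implicit. Unset Printing Implicit Defensive.
Import Order.TTheory GRing.Theory Num.Theory.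
Local Open Scope ring_scope.

(* The roots are 2 cos (2 pi j / 7), for j = 1, 2, 3. *)
Definition hept {F : pzRingType} (x : F) : F := x ^+ 3 + x ^+ 2 - 2 * x - 1.

(** * Subfields and adjunction of a square root *)

Record subfield_pred (F : fieldType) (K : F -> Prop) : Prop := SubfieldPred {
  sfp1 : K 1;
  sfpB : forall x y, K x -> K y -> K (x - y);
  sfpM : forall x y, K x -> K y -> K (x * y);
  sfpV : forall x, K x -> K x^-1 }.

Section Closure.
Variables (F : fieldType) (K : F -> Prop) (Kf : subfield_pred K).
Implicit Types x y : F.

Lemma sfp0 : K 0.
Proof. by rewrite -(subrr 1); apply: (sfpB Kf); apply: (sfp1 Kf). Qed.
Lemma sfpN x : K x -> K (- x).
Proof. by move=> Kx; rewrite -sub0r; apply: (sfpB Kf) => //; apply: sfp0. Qed.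
Lemma sfpD x y : K x -> K y -> K (x + y).
Proof. by move=> Kx Ky; rewrite -(opprK y); apply: (sfpB Kf) => //; apply: sfpN. Qed.
Lemma sfp_nat n : K n%:R.
Proof.
elim: n => [|n IHn]; first exact: sfp0.
by rewrite -natr1; apply: sfpD => //; apply: (sfp1 Kf).
Qed.
Lemma sfp_int (k : int) : K k%:~R.
Proof.
case: k => n; first exact: sfp_nat.
by rewrite NegzE mulrNz; apply/sfpN/sfp_nat.
Qed.
Lemma sfpX x n : K x -> K (x ^+ n).
Proof.
move=> Kx; elim: n => [|n IHn]; first exact: (sfp1 Kf).
by rewrite exprS; apply: (sfpM Kf).
Qed.
Lemma sfp_div x y : K x -> K y -> K (x / y).
Proof. by move=> Kx Ky; apply: (sfpM Kf) => //; apply: (sfpV Kf). Qed.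
End Closure.

Ltac subfield Kf := solve [repeat first [solve [trivial] | apply: (sfpB Kf)
  | apply: (sfpD Kf) | apply: (sfpN Kf) | apply: (sfpM Kf) | apply: (sfpX Kf)
  | apply: (sfp_nat Kf) | apply: (sfp1 Kf) | apply: (sfp0 Kf)]].

(** For [w * w] in [K] this is the field K(w); [w] may already lie in [K]. *)
Definition adjoin (F : fieldType) (K : F -> Prop) (w z : F) :=
  exists a b, [/\ K a, K b & z = a + b * w].

Section Adjoin.
Variables (F : fieldType) (K : F -> Prop) (w : F).
Implicit Types z : F.
Hypotheses (Kf : subfield_pred K) (Kw : K (w * w)).

Lemma adjoin_sub z : K z -> adjoin K w z.
Proof. by move=> Kz; exists z, 0; split; rewrite ?mul0r ?addr0 //; apply: sfp0. Qed.

Lemma adjoin_gen : adjoin K w w.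
Proof. by exists 0, 1; rewrite mul1r add0r; split; [apply: sfp0|apply: (sfp1 Kf)|]. Qed.

Lemma adjoin_subfield : subfield_pred (adjoin K w).
Proof.
split.
- exact/adjoin_sub/(sfp1 Kf).
- move=> _ _ [a [b [Ka Kb ->]]] [c [d [Kc Kd ->]]].
  exists (a - c), (b - d); split; [subfield Kf|subfield Kf|ring].
- move=> _ _ [a [b [Ka Kb ->]]] [c [d [Kc Kd ->]]].
  exists (a * c + b * d * (w * w)), (a * d + b * c); split.
  + by subfield Kf.
  + by subfield Kf.
  + by ring.
move=> z [a [b [Ka Kb zE]]]; set n := a * a - b * b * (w * w).
have Kn : K n by subfield Kf.
have zn : z * (2 * a - z) = n by rewrite zE /n; ring.
have K2a : K (2 * a) by subfield Kf.
(* [n] is the norm of [z]. It can vanish for nonzero [z] if [w] lies in [K], but then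
   [z = 2 * a]. *)
have [n0|n_neq0] := eqVneq n 0.
  apply/adjoin_sub/(sfpV Kf); move/eqP: zn; rewrite n0 mulf_eq0 => /orP[]/eqP.
    by move->; apply: sfp0.
  by move/subr0_eq=> <-.
have z0 : z != 0 by apply: contraNneq n_neq0 => z0; rewrite -zn z0 mul0r.
exists (a / n), (- b / n); split.
- exact: sfp_div.
- by apply: sfp_div => //; apply: sfpN.
- apply: (mulfI z0); rewrite divff //; apply: (mulIf n_neq0).
  by rewrite mul1r -[LHS]zn zE; field.
Qed.

(* If [a + b w] is a root with [b != 0] and [w] is not in [K], then so is
   [a - b w], and since the three roots sum to [-1] the third one,
   [-1 - 2 a], lies in [K]. *)
Lemma adjoin_hept :
  (forall z, K z -> hept z != 0) -> forall z, adjoin K w z -> hept z != 0.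
Proof.
move=> Kroot z [a [b [Ka Kb zE]]]; apply/eqP => z_root.
set x := w * w; have Kx : K x by [].
(* Splitting by parity in [w] gives [hept z = A + b * B * w]. As [b] is nonzero, [w] would lie in
   [K] unless [B = 0]. *)
set A := a ^+ 3 + 3 * a * b ^+ 2 * x + a ^+ 2 + b ^+ 2 * x - 2 * a - 1.
set B := 3 * a ^+ 2 + b ^+ 2 * x + 2 * a - 2.
have KA : K A.
  by rewrite /A; subfield Kf.
have KBb : K B.
  by rewrite /B; subfield Kf.
have AB : A + b * B * w = 0.
  by rewrite -z_root zE /hept /A /B /x; ring.
have Kz_false : ~ K z by move/Kroot; rewrite z_root eqxx.
have b0 : b != 0.
  by apply: contra_notN Kz_false => /eqP b0; rewrite zE b0 mul0r addr0.
have [B0|B0] := eqVneq B 0; last first.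
  apply: Kz_false; rewrite zE; apply: (sfpD Kf) => //; apply: (sfpM Kf) => //.
  have -> : w = - A / (b * B).
    have -> : A = - (b * B * w) by apply/eqP; rewrite -addr_eq0 AB.
    by field; apply/andP.
  by apply: sfp_div => //; [exact: sfpN|exact: (sfpM Kf)].
have Kt : K (-1 - 2 * a).
  by subfield Kf.
have /eqP[] := Kroot _ Kt.
rewrite B0 mulr0 mul0r addr0 in AB.
have bx : b ^+ 2 * x = 2 - 2 * a - 3 * a ^+ 2.
  by apply/eqP; rewrite -subr_eq0 -[X in _ == X]B0; apply/eqP; rewrite /B; ring.
rewrite -AB /A -mulrA bx /hept; ring.
Qed.
End Adjoin.

(** * Absence of rational roots *)

Lemma int_parity (n : int) : exists a, n = 2 * a \/ n = 2 * a + 1.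
Proof. by exists (n %/ 2)%Z; lia. Qed.

(** Modulo 2 the homogenised cubic n^3 + n^2 d + d^3 vanishes only when n and d are both even,
    against coprimality. *)
Lemma hept_rat (q : rat) : hept q != 0.
Proof.
apply/eqP; move: (coprime_num_den q) (denq_neq0 q) (divq_num_den q).
move: (numq q) (denq q) => n d cop d0 <- q_root.
have {}d0 : d%:~R != 0 :> rat by rewrite intr_eq0.
have : n ^+ 3 + n ^+ 2 * d - 2 * n * d ^+ 2 - d ^+ 3 = 0.
  apply/eqP; rewrite -(intr_eq0 rat) !(rmorphB, rmorphD, rmorphM, rmorphXn) /=.
  by rewrite -(mulr0 (d%:~R ^+ 3)) -q_root /hept; apply/eqP; field.
have odd_neq0 k : 2 * k + 1 <> 0 :> int by lia.
have [a na] := int_parity n; have [b db] := int_parity d.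
move: na db cop => [] -> [] -> cop.
- have : (2 %| gcdn `|(2 * a)%R| `|(2 * b)%R|)%N.
    by rewrite dvdn_gcd !abszM !dvdn_mulr.
  by rewrite (eqP cop).
- rewrite [LHS](_ : _ = 2 * (4 * a ^+ 3 + 2 * a ^+ 2 * (2 * b + 1)
    - 2 * a * (2 * b + 1) ^+ 2 - 4 * b ^+ 3 - 6 * b ^+ 2 - 3 * b - 1) + 1).
    exact: odd_neq0.
  by ring.
- rewrite [LHS](_ : _ = 2 * (4 * a ^+ 3 + 6 * a ^+ 2 + 3 * a
    + (2 * a + 1) ^+ 2 * b - (2 * a + 1) * (2 * b) ^+ 2 - 4 * b ^+ 3) + 1).
    exact: odd_neq0.
  by ring.
- rewrite [LHS](_ : _ = 2 * (4 * a ^+ 3 + 6 * a ^+ 2 + 3 * a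
    + (2 * a ^+ 2 + 2 * a) * (2 * b + 1) + b - (2 * a + 1) * (2 * b + 1) ^+ 2
    - 4 * b ^+ 3 - 6 * b ^+ 2 - 3 * b) + 1).
    exact: odd_neq0.
  by ring.
Qed.

(** * Fields containing the values computed along a run *)

Section Runs.
Variable R : rcfType.
Local Notation C := R[i].

Record hept_free (K : C -> Prop) : Prop := HeptFree {
  hf_subfield : subfield_pred K;
  hf_conj : forall x, K x -> K (conjc x);
  hf_noroot : forall x, K x -> hept x != 0 }.

Lemma hept_free_rat : hept_free (fun x => exists q : rat, x = ratr q).
Proof.
split.
- split=> [|_ _ [p ->] [q ->]|_ _ [p ->] [q ->]|_ [p ->]].
  + by exists 1; rewrite rmorph1.
  + by exists (p - q); rewrite rmorphB.
  + by exists (p * q); rewrite rmorphM.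
  + by exists (p^-1); rewrite fmorphV.
- by move=> _ [q ->]; exists q; rewrite fmorph_rat.
- move=> _ [q ->]; have := hept_rat q.
  rewrite -(fmorph_eq0 (ratr : {rmorphism rat -> C})) /hept.
  by rewrite !(rmorphB, rmorphD, rmorphM, rmorphXn, rmorph1, rmorph_nat).
Qed.

(** Adjoining [w] alone may break stability under conjugation, so its conjugate, whose square is the
    conjugate of [w * w], is adjoined next. *)
Lemma hept_free_sqrt (K : C -> Prop) (w : C) : hept_free K -> K (w * w) ->
  exists K', [/\ hept_free K', K' w & forall x, K x -> K' x].
Proof.
move=> [Kf Kc Kr] Kw; pose L := adjoin K w.
have Lf : subfield_pred L by apply: adjoin_subfield.
have Lw : L (conjc w * conjc w).
  by rewrite -rmorphM; apply: adjoin_sub => //; apply: Kc.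
exists (adjoin L (conjc w)); split; last first.
- by move=> x Kx; do 2![apply: adjoin_sub => //].
- by apply: adjoin_sub => //; apply: adjoin_gen.
split; first exact: adjoin_subfield.
- move=> _ [_ [_ [[a [b [Ka Kb ->]]] [c [d [Kc' Kd ->]]] ->]]].
  (* Conjugation swaps the two generators, hence the coefficients [b] and [c]. *)
  exists (conjc a + conjc c * w), (conjc b + conjc d * w); split.
  + by exists (conjc a), (conjc c); split=> //; apply: Kc.
  + by exists (conjc b), (conjc d); split=> //; apply: Kc.
  + rewrite !rmorphD !rmorphM !rmorphD !rmorphM /= conjcK; ring.
- by apply: adjoin_hept => //; apply: adjoin_hept.
Qed.

(** Induction on the run with [K] varying: only a square root node enlarges it, whichever root is
    taken. *)
Lemma qrun_hept_free n s (t : qtree n) (cen rad : 'I_n -> C) K :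
  qrun s t cen rad -> hept_free K -> {in s, forall x, K x} ->
  exists K', [/\ hept_free K', forall v, K' (cen v) & forall v, K' (rad v)].
Proof.
have rconsK (L : C -> Prop) s' x :
    {in s', forall y, L y} -> L x -> {in rcons s' x, forall y, L y}.
  by move=> Ls Lx y; rewrite mem_rcons inE => /predU1P[->|/Ls].
move=> run; elim: run K => {s t cen rad}
  [s fc fr fcs frs|s k t cen rad _ IH|s i j t cen rad si sj _ IH
  |s i j t cen rad si sj _ IH|s i j t cen rad si sj _ IH
  |s i j t cen rad si sj _ _ IH|s i w t cen rad si w2 _ IH
  |s i t cen rad si _ IH|s i t1 t2 cen rad _ _ _ IH
  |s i t1 t2 cen rad _ _ _ IH] K Kh Ks.
- by exists K; split=> // v; apply/Ks/mem_nth; [apply: fcs|apply: frs].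
- by apply: (IH _ Kh); apply: rconsK => //; apply: (sfp_int (hf_subfield Kh)).
- apply: (IH _ Kh); apply: rconsK => //.
  by apply: (sfpD (hf_subfield Kh)); apply/Ks/mem_nth.
- apply: (IH _ Kh); apply: rconsK => //.
  by apply: (sfpB (hf_subfield Kh)); apply/Ks/mem_nth.
- apply: (IH _ Kh); apply: rconsK => //.
  by apply: (sfpM (hf_subfield Kh)); apply/Ks/mem_nth.
- apply: (IH _ Kh); apply: rconsK => //.
  by apply: (sfp_div (hf_subfield Kh)); apply/Ks/mem_nth.
- have [|L [Lh Lw KL]] := hept_free_sqrt (w := w) Kh.
    by rewrite w2; apply/Ks/mem_nth.
  by apply: (IH _ Lh); apply: rconsK => // x /Ks/KL.
- by apply: (IH _ Kh); apply: rconsK => //; apply/(hf_conj Kh)/Ks/mem_nth.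
- exact: (IH K Kh Ks).
- exact: (IH K Kh Ks).
Qed.
End Runs.

(* With d_k = f (k + 1) - f k, one has d_(3+k) + d_(3-k) = t_k d_3 for the
   Chebyshev values t_1 = lam, t_2 = lam^2 - 2, t_3 = lam^3 - 3 lam, and the
   seven differences sum to [f 7 - f 0]. *)
Lemma hept_cycle (F : comPzRingType) (f : nat -> F) (lam m : F) :
  (forall i, f i.+2 + f i = lam * f i.+1 + m) -> f 7 = f 0 ->
  (f 4 - f 3) * hept lam = 0.
Proof.
move=> rec cyc; have next i : f i.+2 = lam * f i.+1 + m - f i.
  by rewrite -rec addrK.
have prev i : f i = lam * f i.+1 + m - f i.+2 by rewrite -rec addrC addKr.
have -> : (f 4 - f 3) * hept lam = f 7 - f 0.
  rewrite (next 5) (next 4) (next 3) (prev 0) (prev 1) (prev 2) /hept; ring.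
by rewrite cyc subrr.
Qed.

(** * Closed chains of seven circles in Lorentzian space *)

Section Chain.
Variable F : numFieldType.
Implicit Types u v w : 'rV[F]_4.

Definition row4 (a b c d : F) : 'rV[F]_4 := \row_j [:: a; b; c; d]`_j.

(* Twice the usual Lorentzian form, so that it has integer entries: circles are
   externally tangent when their product is [-2]. *)
Definition lorentz : 'M[F]_4 := \matrix_(i < 4, j < 4)
  if (i + j == 3)%N then if (i == 0 :> nat) || (j == 0 :> nat) then -1 else 1 else 0.

Definition dot u v : F := (u *m lorentz *m v^T) 0 0.

Lemma dot_row4 a b c d a' b' c' d' :
  dot (row4 a b c d) (row4 a' b' c' d') = b * c' + c * b' - a * d' - d * a'.
Proof.
rewrite /dot mxE !big_ord_recl big_ord0 !mxE !big_ord_recl !big_ord0 !mxE /=.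
ring.
Qed.

Lemma dotC u v : dot u v = dot v u.
Proof.
rewrite /dot !mxE !big_ord_recl !big_ord0 !mxE !big_ord_recl !big_ord0 !mxE /=.
ring.
Qed.

Lemma dotDl u v w : dot (u + v) w = dot u w + dot v w.
Proof. by rewrite /dot !mulmxDl mxE. Qed.
Lemma dotBl u v w : dot (u - v) w = dot u w - dot v w.
Proof. by rewrite /dot !mulmxBl !mxE. Qed.

Lemma dotZl a u w : dot (a *: u) w = a * dot u w.
Proof. by rewrite /dot -!scalemxAl mxE. Qed.
Lemma dotBr u v w : dot w (u - v) = dot w u - dot w v.
Proof. by rewrite !(dotC w) dotBl. Qed.
Lemma dot0l w : dot 0 w = 0.
Proof. by rewrite /dot !mul0mx mxE. Qed.

Lemma lorentz_unit : lorentz \in unitmx.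
Proof.
suff /mulmx1_unit[] : lorentz *m lorentz = 1%:M by [].
apply/matrixP => i j; rewrite !mxE !big_ord_recl big_ord0 !mxE.
by case: i => -[|[|[|[|i]]]] // ?; case: j => -[|[|[|[|j]]]] // ? /=; ring.
Qed.

Lemma dot_eq0 (A : 'M[F]_4) w :
  row_free A -> (forall i, dot w (row i A) = 0) -> w = 0.
Proof.
rewrite row_free_unit => A_unit wA.
have wJA : w *m lorentz *m A^T = 0.
  apply/rowP => i; rewrite [RHS]mxE -(wA i) /dot !mxE.
  by apply: eq_bigr => k _; rewrite !mxE.
have JA_unit : lorentz *m A^T \in unitmx.
  by rewrite unitmx_mul lorentz_unit unitmx_tr.
by rewrite -[w](mulmxK JA_unit) mulmxA wJA mul0mx.
Qed.

(* The difference of the two sides is orthogonal to [a], [b], [c] and [q - p],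
   which form a basis. *)
Lemma chain_step a b c p q D :
    dot a a = 2 -> dot b b = 2 -> dot a b = -2 * D -> D != -1 ->
    dot c c = 2 -> dot p p = 2 -> dot q q = 2 -> dot p q != 2 ->
    dot a c = -2 -> dot a p = -2 -> dot a q = -2 ->
    dot b c = -2 -> dot b p = -2 -> dot b q = -2 ->
    dot p c = -2 -> dot q c = -2 ->
  q + p = ((6 - 2 * D) / (1 + D)) *: c + (4 / (1 + D)) *: (a + b).
Proof.
move=> aa bb ab D1 cc pp qq pq ac ap aq bc bp bq pc qc.
have D1' : 1 + D != 0 by rewrite addrC addr_eq0.
set x := q + p; set y := _ + _; apply/eqP; rewrite -subr_eq0; apply/eqP.
pose A : 'M[F]_4 := \matrix_i [:: a; b; c; q - p]`_i.
have [ba ca pa qa] : [/\ dot b a = -2 * D, dot c a = -2, dot p a = -2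
  & dot q a = -2] by rewrite (dotC b) (dotC c) (dotC p) (dotC q).
have [cb pb qb] : [/\ dot c b = -2, dot p b = -2 & dot q b = -2].
  by rewrite (dotC c) (dotC p) (dotC q).
have [cp cq qp] : [/\ dot c p = -2, dot c q = -2 & dot q p = dot p q].
  by rewrite (dotC c p) (dotC c q) (dotC q p).
(* The coefficients of [y] are those forced by the products with [a] and [c]; with [q - p] both
   sides give 0. *)
apply: (@dot_eq0 A) => [|i]; last first.
  rewrite rowK /x /y; case: i => -[|[|[|[|i]]]] //= _;
  rewrite ?dotBr !dotBl !dotDl !dotZl !dotDl ?(aa, bb, ab, cc, pp, qq, qp);
  rewrite ?(ba, ca, pa, qa, cb, pb, qb, cp, cq, ac, ap, aq, bc, bp, bq, pc, qc);
  by field.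
(* Independence: [q - p] is orthogonal to [a], [b], [c] and not isotropic, so [z3 = 0]; the other
   three equations are solvable since [1 + D] is nonzero. *)
apply: inj_row_free => z; rewrite mulmx_sum_row !big_ord_recl big_ord0 !rowK /=.
set z0 := z 0 _; set z1 := z 0 _; set z2 := z 0 _; set z3 := z 0 _ => zA.
have zdot w := etrans (congr1 (fun t => dot t w) zA) (dot0l w).
have := zdot a; have := zdot b; have := zdot c; have := zdot (q - p).
rewrite !dotBr !dotDl !dotZl !dotBl !dot0l.
rewrite ?(aa, bb, ab, cc, pp, qq, qp).
rewrite ?(ba, ca, pa, qa, cb, pb, qb, cp, cq, ac, ap, aq, bc, bp, bq, pc, qc).
move=> ze zc zb za.
have two0 : 2 != 0 :> F by rewrite pnatr_eq0.
have pq0 : 4 - 2 * dot p q != 0.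
  apply: contraNneq pq => pq4; apply/eqP/(mulfI two0)/eqP.
  by rewrite eq_sym -subr_eq0 -[X in _ == X]pq4; apply/eqP; ring.
have z30 : z3 = 0 by apply: (mulIf pq0); rewrite mul0r -[RHS]ze; ring.
have {}za : 2 * z0 - 2 * D * z1 - 2 * z2 = 0 by rewrite -[RHS]za z30; ring.
have {}zb : 2 * z1 - 2 * D * z0 - 2 * z2 = 0 by rewrite -[RHS]zb z30; ring.
have {}zc : 2 * z2 - 2 * z0 - 2 * z1 = 0 by rewrite -[RHS]zc z30; ring.
have z01 : z0 + z1 = 0.
  apply: (mulfI (mulf_neq0 two0 D1')).
  transitivity (- (2 * z0 - 2 * D * z1 - 2 * z2) - (2 * z1 - 2 * D * z0 - 2 * z2)
    - 2 * (2 * z2 - 2 * z0 - 2 * z1)); first by ring.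
  by rewrite za zb zc; ring.
have z20 : z2 = 0.
  apply: (mulfI two0).
  transitivity ((2 * z2 - 2 * z0 - 2 * z1) + 2 * (z0 + z1)); first by ring.
  by rewrite zc z01; ring.
have z00 : z0 = 0.
  apply: (mulfI (mulf_neq0 two0 D1')).
  transitivity ((2 * z0 - 2 * D * z1 - 2 * z2) + 2 * D * (z0 + z1) + 2 * z2).
    by ring.
  by rewrite za z01 z20; ring.
have z10 : z1 = 0 by rewrite -z01 z00 add0r.
apply/rowP => i; rewrite mxE; case: i => -[|[|[|[|i]]]] // i_lt.
- by rewrite -[RHS]z00; congr (z 0 _); apply: val_inj.
- by rewrite -[RHS]z10; congr (z 0 _); apply: val_inj.
- by rewrite -[RHS]z20; congr (z 0 _); apply: val_inj.
- by rewrite -[RHS]z30; congr (z 0 _); apply: val_inj.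
Qed.

(** [hept_cycle] applies to each coordinate. If [hept lam] were nonzero then [c 4 = c 3], but their
    product is -2 and not 2. *)
Lemma chain_hept (a b : 'rV[F]_4) (c : nat -> 'rV[F]_4) D :
    dot a a = 2 -> dot b b = 2 -> dot a b = -2 * D -> D != -1 ->
    (forall i, [/\ dot (c i) (c i) = 2, dot (c i) a = -2, dot (c i) b = -2,
       dot (c i) (c i.+1) = -2 & dot (c i) (c i.+2) != 2]) ->
    c 7 = c 0 ->
  hept ((6 - 2 * D) / (1 + D)) = 0.
Proof.
move=> aa bb ab D1 cP cyc.
set lam := (6 - 2 * D) / (1 + D).
have step i : c i.+2 + c i = lam *: c i.+1 + (4 / (1 + D)) *: (a + b).
  have [ii ia ib ij ik] := cP i; have [jj ja jb jk _] := cP i.+1.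
  have [kk ka kb _ _] := cP i.+2.
  by apply: chain_step; rewrite // dotC.
have c43 : c 4 != c 3.
  have [c33 _ _ c34 _] := cP 3; apply: contra_eq_neq c34 => ->.
  by rewrite c33 -subr_eq0 opprK -natrD pnatr_eq0.
have [//|lam_hept] := eqVneq (hept lam) 0.
case/eqP: c43; apply/rowP => i.
apply/eqP; rewrite -subr_eq0; apply/eqP/(mulIf lam_hept); rewrite mul0r.
apply: (@hept_cycle _ (fun k => c k 0 i) _ ((4 / (1 + D)) * (a + b) 0 i)).
  by move=> k; have := congr1 (fun v : 'rV_4 => v 0 i) (step k); rewrite !mxE.
by rewrite cyc.
Qed.

(** [z'] stands for the conjugate of [z]; as a separate argument it keeps the algebra free of
    conjugation. *)
Definition circle_vec (z z' r : F) :=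
  row4 (1 / r) (z / r) (z' / r) ((z * z' - r ^+ 2) / r).

Lemma dot_circle z1 z1' r1 z2 z2' r2 : r1 != 0 -> r2 != 0 ->
  dot (circle_vec z1 z1' r1) (circle_vec z2 z2' r2) =
  (r1 ^+ 2 + r2 ^+ 2 - (z1 - z2) * (z1' - z2')) / (r1 * r2).
Proof. by move=> r10 r20; rewrite dot_row4; field; apply/andP. Qed.

End Chain.

(** * Disjointness and tangency in terms of distances *)

Section Geometry.
Variable R : rcfType.
Local Notation C := R[i].
Implicit Types z w r s : C.

Lemma interior_dist z r w s : 0 < r -> 0 < s ->
  ~ (exists x, in_interior z r x /\ in_interior w s x) <-> r + s <= `|z - w|.
Proof.
move=> r0 s0; have rs0 : 0 < r + s by apply: addr_gt0.
split=> [disj|rs [x [zx wx]]]; last first.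
  suff : r + s < r + s by rewrite ltxx.
  apply: le_lt_trans rs (le_lt_trans (ler_distD x z w) _).
  by rewrite ltrD // distrC.
rewrite real_leNgt ?normr_real ?(gtr0_real rs0) //; apply/negP => lt_rs.
(* The point dividing the segment of centres in the ratio r : s. *)
apply: disj; exists (z + (w - z) * (r / (r + s))).
have rs_neq0 := lt0r_neq0 rs0.
rewrite /in_interior; split.
  rewrite addrC addKr normrM distrC (gtr0_norm (divr_gt0 r0 rs0)).
  by rewrite mulrCA gtr_pMr // ltr_pdivrMr // mul1r.
rewrite (_ : _ - w = (z - w) * (s / (r + s))); last by field.
rewrite normrM (gtr0_norm (divr_gt0 s0 rs0)).
by rewrite mulrCA gtr_pMr // ltr_pdivrMr // mul1r.
Qed.

(** Only an inequality, since a single common point also allows internal tangency; disjoint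
    interiors supply the converse. *)
Lemma tangent_le_dist z r w s : tangent z r w s -> `|z - w| <= r + s.
Proof.
by case=> x [[<- <-] _]; rewrite (distrC x z) ler_distD.
Qed.

Lemma dist_tangent z r w s : 0 < r -> 0 < s -> `|z - w| = r + s ->
  tangent z r w s.
Proof.
move=> r0 s0 zw; have rs0 : 0 < r + s by apply: addr_gt0.
have rs_neq0 := lt0r_neq0 rs0.
exists (z + (w - z) * (r / (r + s))); rewrite /on_circle; split.
  split.
    rewrite addrC addKr normrM distrC (gtr0_norm (divr_gt0 r0 rs0)) zw; field.
    by [].
  rewrite (_ : _ - w = (z - w) * (s / (r + s))); last by field.
  by rewrite normrM (gtr0_norm (divr_gt0 s0 rs0)) zw; field.
move=> x zx wx.
have rJ : r^* = r by apply/CrealP/gtr0_real.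
have sJ : s^* = s by apply/CrealP/gtr0_real.
have e1 := normCK (x - z); have e2 := normCK (x - w); have e3 := normCK (z - w).
rewrite zx in e1; rewrite wx in e2; rewrite zw in e3.
rewrite !rmorphB in e1, e2, e3.
(* The squared norm of this vector is given by Stewart's identity, and the three known distances
   make it 0. *)
suff : s * (x - z) + r * (x - w) = 0.
  move=> e; apply: (mulfI rs_neq0); rewrite -[LHS]addr0.
  rewrite -[X in _ + X]oppr0 -e; field.
  by [].
apply/eqP; rewrite -normr_eq0 -sqrf_eq0 normCK !(rmorphD, rmorphM, rmorphB) /=.
rewrite rJ sJ; apply/eqP.
transitivity (s * (r + s) * ((x - z) * (x^* - z^*))
  + r * (r + s) * ((x - w) * (x^* - w^*)) - r * s * ((z - w) * (z^* - w^*))); first by ring.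
by rewrite -e1 -e2 -e3; ring.
Qed.
End Geometry.

(* Vertices 0 to 6 form the cycle, 7 and 8 are the apexes. *)
Definition bipyramid : rel 'I_9 := fun u v =>
  if (u < 7)%N && (v < 7)%N then (u.+1 %% 7 == v)%N || (v.+1 %% 7 == u)%N
  else (u < 7)%N != (v < 7)%N.

Lemma bipyramid_simple : simple_graph bipyramid.
Proof.
split=> [u v|u]; rewrite /bipyramid.
  by rewrite andbC orbC [(u < 7)%N == _]eq_sym.
by case: ltnP => [u7|u7] /=; rewrite ?eqxx // orbb; lia.
Qed.

(** * A root of the cubic from any packing *)

Section Impossible.
Variable R : rcfType.
Local Notation C := R[i].
Variables cen rad : 'I_9 -> C.
Hypothesis packing : circle_packing bipyramid cen rad.

Let vec v : 'rV[C]_4 := circle_vec (cen v) (cen v)^* (rad v).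

Let rad_gt0 v : 0 < rad v. Proof. by case: packing. Qed.
Let rad_neq0 v : rad v != 0. Proof. exact: lt0r_neq0. Qed.

Let dot_vec u v : dot (vec u) (vec v) =
  (rad u ^+ 2 + rad v ^+ 2 - `|cen u - cen v| ^+ 2) / (rad u * rad v).
Proof. by rewrite dot_circle // normCK rmorphB. Qed.

Let dot_self v : dot (vec v) (vec v) = 2.
Proof. by rewrite dot_vec subrr normr0 expr0n subr0; field. Qed.

Let dist_vec u v : u != v -> rad u + rad v <= `|cen u - cen v|.
Proof. by case: packing => _ disj _ uv; apply/interior_dist/disj. Qed.

Let dot_adj u v : bipyramid u v -> dot (vec u) (vec v) = -2.
Proof.
move=> uv; have [_ _ /(_ _ _ uv)/tangent_le_dist le_uv] := packing.
have u_neq_v : u != v.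
  by apply: contraTneq uv => ->; case: bipyramid_simple.
rewrite dot_vec (_ : `|_| = rad u + rad v); first by field; rewrite !rad_neq0.
by apply/eqP; rewrite eq_le le_uv dist_vec.
Qed.

(** Product 2 would make the distance the difference of the radii. Used for rim vertices two apart
    and, through [D != -1], for the apexes. *)
Let dot_neq u v : u != v -> dot (vec u) (vec v) != 2.
Proof.
move=> uv; rewrite dot_vec lt_eqF // ltr_pdivrMr ?mulr_gt0 //.
rewrite ltrBlDl -ltrBlDr.
apply: lt_le_trans (_ : (rad u + rad v) ^+ 2 <= _); last first.
  apply: lerXn2r; rewrite ?nnegrE ?dist_vec ?normr_ge0 //.
  by apply/ltW; rewrite addr_gt0.
rewrite -subr_gt0 (_ : _ - _ = 4 * (rad u * rad v)); last by ring.
by rewrite !mulr_gt0.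
Qed.

Let rim i : 'I_9 := inord (i %% 7).
Let rimE i : rim i = (i %% 7)%N :> nat.
Proof. by rewrite inordK //; lia. Qed.

Lemma packing_hept :
  let D := - dot (vec (inord 7)) (vec (inord 8)) / 2 in
  hept ((6 - 2 * D) / (1 + D)) = 0.
Proof.
have two0 : 2 != 0 :> C by rewrite pnatr_eq0.
move=> D; have ab : dot (vec (inord 7)) (vec (inord 8)) = -2 * D.
  by rewrite /D; field.
apply: (@chain_hept _ _ _ (fun i => vec (rim i)) _ _ _ ab) => //.
- apply: contra_neq (@dot_neq (inord 7) (inord 8) _) => [D1|].
    by rewrite ab D1; ring.
  by rewrite -val_eqE /= !inordK.
- have rim7 i : (i %% 7 < 7)%N by rewrite ltn_mod.
  move=> i; split; first exact: dot_self.
  + by apply: dot_adj; rewrite /bipyramid rimE !inordK // rim7.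
  + by apply: dot_adj; rewrite /bipyramid rimE !inordK // rim7.
  + apply: dot_adj; rewrite /bipyramid !rimE !rim7 /=.
    by apply/orP; left; apply/eqP; lia.
  + by apply: dot_neq; rewrite -val_eqE /= !rimE; lia.
Qed.

End Impossible.

Lemma bipyramid_not_constructible (R : rcfType) (t : qtree 9) :
  ~ qtree_constructs_packing R bipyramid t.
Proof.
move=> [cen [rad [run packing]]].
have [//|K [Kh Kcen Krad]] := qrun_hept_free run (hept_free_rat R).
have Kf := hf_subfield Kh.
have /eqP := packing_hept packing; apply/negP; apply: (hf_noroot Kh).
set u := inord 7; set v := inord 8.
set d := dot _ _; have Kd : K d.
  have [rad_gt0 _ _] := packing.
  rewrite /d dot_circle ?lt0r_neq0 //.
  have KcenJ w : K (cen w)^* by apply: (hf_conj Kh).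
  by apply: (sfp_div Kf); subfield Kf.
have KD : K (- d / 2) by apply: (sfp_div Kf); subfield Kf.
by apply: (sfp_div Kf); subfield Kf.
Qed.

(** * Stereographic projection of spherical discs *)

Section Stereographic.
Variables (R : rcfType) (n : nat) (adj : rel 'I_n) (N1 N2 N3 N4 : 'I_n -> R).
Local Notation C := R[i].

(** A disc of centre p and angular radius t has the vector (p, cos t) / sin t; external tangency is
    product -1. *)
Definition lorentz_dot u v := N1 u * N1 v + N2 u * N2 v + N3 u * N3 v - N4 u * N4 v.

(* [N] describes a disc of the unit sphere, projected from (-12/13, 0, 5/13). *)
Definition curv v := N4 v + 12 / 13 * N1 v - 5 / 13 * N3 v.

(** Positive [curv] puts the projection point outside the disc, so that the image is bounded. *)
Hypotheses (N_self : forall v, lorentz_dot v v = 1)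
  (curv_gt0 : forall v, 0 < curv v)
  (N_le : forall u v, u != v -> lorentz_dot u v <= -1)
  (N_adj : forall u v, adj u v -> lorentz_dot u v = -1).

(** Coordinates along (0, 1, 0) and (5/13, 0, 12/13), an orthonormal basis of the plane orthogonal
    to the projection point. *)
Definition centre v : C :=
  (N2 v / curv v +i* ((5 / 13 * N1 v + 12 / 13 * N3 v) / curv v))%C.
Definition radius v : C := ((curv v)^-1)%:C%C.

Lemma norm_centreB u v : `|centre u - centre v| =
  (Num.sqrt (((curv u)^-1 + (curv v)^-1) ^+ 2
     - 2 * (lorentz_dot u v + 1) / (curv u * curv v)))%:C%C.
Proof.
rewrite normc_def; congr (Num.sqrt _)%:C%C.
have ku := lt0r_neq0 (curv_gt0 u); have kv := lt0r_neq0 (curv_gt0 v).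
have hu := N_self u; have hv := N_self v; rewrite /=.
(* The added terms vanish by [N_self] and turn the equality into a field identity. *)
transitivity (((curv u)^-1 + (curv v)^-1) ^+ 2
  - 2 * (lorentz_dot u v + 1) / (curv u * curv v)
  + (lorentz_dot u u - 1) / curv u ^+ 2 + (lorentz_dot v v - 1) / curv v ^+ 2);
  last by rewrite hu hv subrr !mul0r !addr0.
have N4E w : N4 w = curv w - 12 / 13 * N1 w + 5 / 13 * N3 w.
  by rewrite /curv; ring.
rewrite /lorentz_dot !N4E; move: (curv u) (curv v) ku kv => a b a0 b0.
by field; rewrite a0 b0.
Qed.

Lemma stereographic_packing : circle_packing adj centre radius.
Proof.
have r_gt0 v : 0 < radius v by rewrite ltcR invr_gt0.
have kk_gt0 u v : 0 < curv u * curv v by rewrite mulr_gt0.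
have sumE u v : radius u + radius v =
    (Num.sqrt (((curv u)^-1 + (curv v)^-1) ^+ 2))%:C%C.
  by rewrite sqrtr_sqr ger0_norm ?addr_ge0 ?invr_ge0 ?ltW // rmorphD.
split=> // u v uv.
  apply/interior_dist => //; rewrite sumE norm_centreB lecR; apply: ler_wsqrtr.
  rewrite lerDl oppr_ge0 pmulr_lle0 ?invr_gt0 //.
  by rewrite pmulr_rle0 // -lerBrDr sub0r N_le.
apply: dist_tangent => //.
by rewrite sumE norm_centreB N_adj // addNr mulr0 mul0r subr0.
Qed.
End Stereographic.

(** The interval isolates 2 cos (2 pi / 7), about 1.247, and replaces trigonometry in later
    estimates. *)
Lemma hept_root (R : rcfType) :
  exists lam : R, [/\ 6 / 5 <= lam, lam <= 63 / 50 & hept lam = 0].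
Proof.
pose p : {poly R} := 'X ^+ 3 + 'X ^+ 2 - 2%:P * 'X - 1%:P.
have pE x : p.[x] = hept x.
  by rewrite /p /hept !(hornerD, hornerN, hornerM, hornerXn, hornerX, hornerC).
have [||x /andP[x1 x2] /rootP x0] := @poly_ivt _ p (6 / 5) (63 / 50).
- lra.
- by rewrite !pE /hept; apply/andP; split; lra.
by exists x; rewrite -pE x0.
Qed.

(** * The symmetric packing of the sphere *)

Section Existence.
Variables (R : rcfType) (lam : R).
Hypotheses (lam_ge : 6 / 5 <= lam) (lam_le : lam <= 63 / 50) (lam_root : hept lam = 0).

(* [c] and [s] are cos and sin of [2 pi / 7], and [h] is [cos (pi / 7)]. *)
Let c := lam / 2.
Let s := Num.sqrt (1 - c ^+ 2).
Let h := (lam ^+ 2 + lam - 1) / 2.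
(** This is 1 / sin (pi / 7). *)
Let rho := Num.sqrt (2 / (1 - c)).

Fixpoint rot k : R * R :=
  if k is k'.+1 then (c * (rot k').1 - s * (rot k').2, s * (rot k').1 + c * (rot k').2)
  else (1, 0).
Let x k := (rot k).1.
Let y k := (rot k).2.

Let c2s2 : c ^+ 2 + s ^+ 2 = 1.
Proof.
rewrite sqr_sqrtr; first by ring.
rewrite (_ : _ - _ = (1 - c) * (1 + c)); last by ring.
by move: lam_ge lam_le => ? ?; apply: mulr_ge0; rewrite /c; lra.
Qed.

Let h2 : h ^+ 2 = (1 + c) / 2.
Proof.
(* The difference of the sides is [(lam + 1) / 4 * hept lam]. *)
apply/eqP; rewrite -subr_eq0 -(mulr0 ((lam + 1) / 4)) -[in X in _ == X]lam_root.
by apply/eqP; rewrite /h /c /hept; field.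
Qed.

Let h_gt0 : 0 < h. Proof. by move: lam_ge lam_le => ? ?; rewrite /h; nra. Qed.

Let rho2 : rho ^+ 2 = 2 / (1 - c).
Proof. by move: lam_ge lam_le => ? ?; apply/sqr_sqrtr/divr_ge0 => //; rewrite /c; lra. Qed.

Let rho_gt0 : 0 < rho.
Proof. by move: lam_ge lam_le => ? ?; rewrite sqrtr_gt0; apply: divr_gt0 => //; rewrite /c; lra. Qed.

Let rot_dot k i : x (i + k) * x i + y (i + k) * y i = x k.
Proof.
elim: i => [|i IHi]; first by rewrite add0n /x /y /=; ring.
rewrite -[RHS]IHi.
transitivity ((c ^+ 2 + s ^+ 2) * (x (i + k) * x i + y (i + k) * y i)).
  by rewrite addSn /x /y /=; ring.
by rewrite c2s2 mul1r.
Qed.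

(** Eliminating [y] and [s] makes each [x k] a polynomial in [lam]. *)
Let x_rec k : x k.+2 = lam * x k.+1 - x k.
Proof.
transitivity (lam * x k.+1 - (c ^+ 2 + s ^+ 2) * x k).
  by rewrite /x /= /c; field.
by rewrite c2s2 mul1r.
Qed.

Let x_val : [/\ x 0 = 1, x 1 = c, x 2 = 2 * c ^+ 2 - 1, x 3 = - h
  & [/\ x 4 = - h, x 5 = 2 * c ^+ 2 - 1 & x 6 = c]].
Proof.
have lam3 : lam ^+ 3 = 1 + 2 * lam - lam ^+ 2.
  by apply/eqP; rewrite -subr_eq0 -[in X in _ == X]lam_root /hept; apply/eqP; ring.
have x0 : x 0 = 1 by [].
have x1 : x 1 = c by rewrite /x /=; ring.
have x2 : x 2 = 2 * c ^+ 2 - 1 by rewrite x_rec x1 x0 /c; field.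
have x3 : x 3 = - h.
  rewrite x_rec x2 x1 (_ : _ - _ = (lam ^+ 3 - 3 * lam) / 2); last by rewrite /c; field.
  by rewrite lam3 /h; field.
have x4 : x 4 = - h.
  rewrite x_rec x3 x2 /h /c.
  rewrite (_ : _ - _ = - (lam ^+ 3 + 2 * lam ^+ 2 - lam - 2) / 2); last by field.
  by rewrite lam3; field.
have x5 : x 5 = 2 * c ^+ 2 - 1.
  rewrite x_rec x4 x3 /h /c.
  rewrite (_ : _ - _ = (- lam ^+ 3 + 2 * lam - 1) / 2); last by field.
  by rewrite lam3; field.
have x6 : x 6 = c.
  rewrite x_rec x5 x4 /h /c.
  rewrite (_ : _ - _ = (lam ^+ 3 + lam ^+ 2 - lam - 1) / 2); last by field.
  by rewrite lam3; field.
by [].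
Qed.

(** Keeps the projection point outside the rim discs, since 12/13 < 1. Discs 3 and 4 touch at (-1,
    0, 0), so a point off the equator is chosen. *)
Let x_ge k : (k < 7)%N -> - h <= x k.
Proof.
have [x0 x1 x2 x3 [x4 x5 x6]] := x_val.
move: lam_ge lam_le => ? ?.
by case: k => [|[|[|[|[|[|[|k]]]]]]] // _; rewrite ?(x0, x1, x2, x3, x4, x5, x6) /h /c; nra.
Qed.

Let x_le k : (0 < k < 7)%N -> x k <= c.
Proof.
have [x0 x1 x2 x3 [x4 x5 x6]] := x_val.
move: lam_ge lam_le => ? ?.
by case: k => [|[|[|[|[|[|[|k]]]]]]] // _; rewrite ?(x0, x1, x2, x3, x4, x5, x6) /h /c; nra.
Qed.

(** Rim discs have radius pi / 7 and centres on the equator; the apexes are polar caps of radius pi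
    / 2 - pi / 7. *)
Let N1 (v : 'I_9) := if (v < 7)%N then rho * x v else 0.
Let N2 (v : 'I_9) := if (v < 7)%N then rho * y v else 0.
Let N3 (v : 'I_9) :=
  if (v < 7)%N then 0 else if v == 7 :> nat then h^-1 else - h^-1.
Let N4 (v : 'I_9) := if (v < 7)%N then rho * h else (rho * h)^-1.
Let N := lorentz_dot N1 N2 N3 N4.

Let h_neq0 : h != 0. Proof. exact: lt0r_neq0. Qed.
Let rho_neq0 : rho != 0. Proof. exact: lt0r_neq0. Qed.
Let c_lt1 : 0 < 1 - c.
Proof. by move: lam_ge lam_le => ? ?; rewrite /c; lra. Qed.
Let c_gt0 : 0 < c.
Proof. by move: lam_ge lam_le => ? ?; rewrite /c; lra. Qed.

Let N_sym u v : N u v = N v u.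
Proof. by rewrite /N /lorentz_dot; ring. Qed.

Let N_rim (u v : 'I_9) k : (u < 7)%N -> (v < 7)%N -> u = (k + v)%N :> nat ->
  N u v = rho ^+ 2 * (x k - h ^+ 2).
Proof.
move=> u7 v7 uE; rewrite /N /lorentz_dot /N1 /N2 /N3 /N4 u7 v7 -(rot_dot k v).
by rewrite uE addnC; ring.
Qed.

Let N_rim_apex (u v : 'I_9) : (u < 7)%N -> (v < 7)%N = false -> N u v = -1.
Proof.
move=> u7 v7; rewrite /N /lorentz_dot /N1 /N2 /N3 /N4 u7 v7.
by field; rewrite h_neq0 rho_neq0.
Qed.

Let N_apex (u v : 'I_9) : (u < 7)%N = false -> (v < 7)%N = false ->
  N u v = (if u == v then 1 else - ((3 - c) / (1 + c))).
Proof.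
have c1_neq0 : 1 + c != 0 by apply/lt0r_neq0/addr_gt0.
have c2_neq0 := lt0r_neq0 c_lt1.
move=> u7 v7; rewrite /N /lorentz_dot /N1 /N2 /N3 /N4 u7 v7 -val_eqE /=.
have h2V : h^-1 * h^-1 = 2 / (1 + c).
  by rewrite -invfM -expr2 h2; field.
have r2V : (rho * h)^-1 * (rho * h)^-1 = (1 - c) / (1 + c).
  rewrite invfM mulrACA h2V -invfM -expr2 rho2; field.
  by rewrite c1_neq0 c2_neq0.
rewrite r2V; have u9 := ltn_ord u; have v9 := ltn_ord v.
have [v7'|v8] : v = 7 :> nat \/ v = 8 :> nat by lia.
  have [-> | ->] : u = 7 :> nat \/ u = 8 :> nat by lia.
    by rewrite v7' /= h2V; field.
  by rewrite v7' /= mulNr h2V; field.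
have [-> | ->] : u = 7 :> nat \/ u = 8 :> nat by lia.
  by rewrite v8 /= mulrN h2V; field.
by rewrite v8 /= mulrNN h2V; field.
Qed.

Let rho2_neg : rho ^+ 2 * (c - h ^+ 2) = -1.
Proof. by rewrite rho2 h2; field; apply: lt0r_neq0. Qed.

(** The northern cap is bounded at height sin (pi / 7), above the height 5/13 of the projection
    point. *)
Let rho_lt : 5 / 13 < rho^-1.
Proof.
have lt_rho : rho < 13 / 5.
  rewrite -(ltr_pXn2r (ltn0Sn 1)) ?nnegrE ?ltW //; last by lra.
  by rewrite rho2 ltr_pdivrMr //; move: lam_le => ?; rewrite /c; lra.
by rewrite -(invrK (5 / 13)) ltf_pV2 ?posrE ?invf_div //; lra.
Qed.

Let N_rim_adj (u v : 'I_9) : (u < 7)%N -> (v < 7)%N ->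
  (v.+1 %% 7)%N = u -> N u v = -1.
Proof.
have [_ x1 _ _ [_ _ x6]] := x_val => u7 v7 uv.
(* The second case is the wrap-around from vertex 6 to vertex 0. *)
have [uE|vE] : u = (1 + v)%N :> nat \/ v = (6 + u)%N :> nat by lia.
  by rewrite (N_rim u7 v7 uE) x1 rho2_neg.
by rewrite N_sym (N_rim v7 u7 vE) x6 rho2_neg.
Qed.

Let N_rim_le (u v : 'I_9) : (u < 7)%N -> (v < u)%N -> N u v <= -1.
Proof.
move=> u7 vu; rewrite (@N_rim u v (u - v)) //; [|lia|lia].
rewrite -rho2_neg ler_pM2l ?exprn_gt0 // lerD2r x_le //; lia.
Qed.

Lemma bipyramid_packing_lam :
  circle_packing bipyramid (centre N1 N2 N3 N4) (radius N1 N3 N4).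
Proof.
apply: stereographic_packing; rewrite -/N.
- move=> v; have [v7|v7] := boolP (v < 7)%N.
    rewrite (@N_rim v v 0) // rho2 h2; have [-> _ _ _ _] := x_val.
    by field; apply: lt0r_neq0.
  by rewrite N_apex ?eqxx //; apply: negbTE.
- move=> v; rewrite /curv /N1 /N3 /N4; case: ifP => v7.
    rewrite (_ : _ - _ = rho * (h + 12 / 13 * x v)); last by ring.
    by rewrite mulr_gt0 //; move: (x_ge v7) h_gt0 => ? ?; lra.
  rewrite invfM mulr0 addr0; have hV : 0 < h^-1 by rewrite invr_gt0.
  case: ifP => _; last by rewrite mulrN opprK addr_gt0 ?mulr_gt0 ?invr_gt0.
  by rewrite -mulrBl mulr_gt0 // subr_gt0.
- move=> u v uv; case u7 : (u < 7)%N; case v7 : (v < 7)%N.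
  + move: uv; rewrite neq_ltn => /orP[] lt_uv.
      by rewrite N_sym N_rim_le.
    by rewrite N_rim_le.
  + by rewrite N_rim_apex.
  + by rewrite N_sym N_rim_apex.
  + rewrite N_apex // (negbTE uv) lerN2 ler_pdivlMr ?addr_gt0 // mul1r.
    by move: c_lt1 => ?; lra.
- move=> u v; rewrite /bipyramid; case u7 : (u < 7)%N; case v7 : (v < 7)%N => //=.
  + by case/orP=> /eqP uv; [rewrite N_sym|]; apply: N_rim_adj.
  + by rewrite N_rim_apex.
  + by rewrite N_sym N_rim_apex.
Qed.

End Existence.

Lemma bipyramid_packing (R : rcfType) :
  exists cen rad : 'I_9 -> R[i], circle_packing bipyramid cen rad.
Proof.
have [lam [lam_ge lam_le lam_root]] := hept_root R.
by do 2!eexists; apply: (bipyramid_packing_lam lam_ge lam_le lam_root).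
Qed.

Theorem theorem7 :
  exists (n : nat) (adj : rel 'I_n),
    simple_graph adj /\
    forall R : realType,
      (exists cen rad : 'I_n -> R[i], circle_packing adj cen rad) /\
      forall t : qtree n, ~ qtree_constructs_packing R adj t.
Proof.
exists 9, bipyramid; split; first exact: bipyramid_simple.
by move=> R; split; [apply: bipyramid_packing|apply: bipyramid_not_constructible].
Qed.
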